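(* Let $q$ be a power of an odd prime $p$ and let $K$ be a proper subfield of $\mathbb{F}_q$. Let $d \geq 2$ be a divisor of $\frac{q-1}{|K|-1}$ such that $q< d|K|(|K|+1)$. Let $r$ be the remainder of $\frac{q-1}{d}$ divided by $p|K|$. If $r<(p-1)|K|$, then $\omega(GP(q,d))=|K|$.
   Context: $\mathbb{F}_q$ is the finite field with $q$ elements and $\mathbb{F}_q^*=\mathbb{F}_q\setminus\{0\}$. For an integer $d>1$ and an odd prime power $q\equiv 1\pmod{2d}$ (this congruence holds automatically under the hypotheses of the claim), the $d$-Paley graph $GP(q,d)$ is the graph with vertex set $\mathbb{F}_q$ in which two vertices are adjacent if and only if their difference lies in $(\mathbb{F}_q^* )^d=\{x^d: x\in\mathbb{F}_q^*\}$. The clique number $\omega(X)$ of a graph $X$ is the maximum number of vertices of a complete subgraph of $X$. The remainder $r$ is the integer with $0\le r<p|K|$ and $r\equiv \frac{q-1}{d}\pmod{p|K|}$. *)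

(* Defs.v *)
From mathcomp Require Import all_boot all_algebra.

Set Implicit Arguments.
Unset Strict Implicit.
Unset Printing Implicit Defensive.

Definition is_clique (T : finType) (e : rel T) (C : {set T}) : bool :=
  [forall x in C, forall y in C, (x != y) ==> e x y].

Definition clique_number (T : finType) (e : rel T) : nat :=
  \max_(C : {set T} | is_clique e C) #|C|.

Definition nonzero_powers (F : finFieldType) (d : nat) : {set F} :=
  [set (x ^+ d)%R | x : F & x != 0%R].

(* This relation is always irreflexive; it is symmetric when #|F| is odd and
   #|F| = 1 %[mod 2 * d], because -1 is then a d-th power. *)
Definition paley_graph (F : finFieldType) (d : nat) : rel F :=
  [rel x y | (x - y)%R \in nonzero_powers F d].
Arguments paley_graph : clear implicits.

Definition is_subfield (F : finFieldType) (K : {set F}) : Prop :=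
  divring_closed K.

(* Main.v *)
Require Import Defs.
From mathcomp Require Import all_boot all_algebra.
From mathcomp Require Import all_fingroup all_solvable zify.

(** Lower bound: the nonzero elements of [K] are killed by the exponent
    [|K| - 1], which divides [M = (q - 1) / d], so they are [d]-th powers.

    Upper bound (Stepanov's method, after Hanson and Petridis): suppose that
    [b_0, ..., b_m] form a clique with [m = |K|].  Choose weights [c_i] such
    that [\sum_i c_i g(b_i)] is the coefficient of [X^m] in [g] for every [g]
    of degree at most [m], and put
      [f = \sum_i c_i (X + b_i)^(m + M) - 1].
    Then [f] has degree [M], with leading coefficient ['C(m + M, m)], which is
    nonzero mod [p] by the condition on [r]; and [f] vanishes to order [m] at
    each of the [m + 1] points [- b_j], because [(b_i - b_j)^M = 1].
    Hence [m (m + 1) <= M], contradicting [q < d m (m + 1)]. *)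

Set Implicit Arguments.
Unset Strict Implicit.
Unset Printing Implicit Defensive.

Import GRing.Theory FinRing.Theory.

Local Open Scope ring_scope.

(** * Polynomial coefficients, divisibility by coprime factors, and interpolation weights *)

Lemma coef_XaddC_exp (R : comNzRingType) (c : R) (n i : nat) :
  (('X + c%:P) ^+ n)`_i = c ^+ (n - i) *+ 'C(n, i).
Proof.
rewrite addrC exprDn coef_sum.
have Ek (k : 'I_n.+1) : ((c%:P ^+ (n - k) * 'X^k) *+ 'C(n, k))`_i =
    if k == i :> nat then c ^+ (n - i) *+ 'C(n, i) else 0.
  rewrite coefMn -polyC_exp coefCM coefXn eq_sym.
  by case: eqP => [->|_]; rewrite ?mulr1 // mulr0 mul0rn.
rewrite (eq_bigr _ (fun k _ => Ek k)) -big_mkcond /=.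
case: (ltnP i n.+1) => lt_i_n.
  by rewrite (big_pred1 (Ordinal lt_i_n)) // => k; rewrite -val_eqE.
rewrite bin_small // mulr0n big_pred0 // => k.
by apply/negbTE; rewrite neq_ltn (leq_trans (ltn_ord k)).
Qed.

Lemma coprimep_prod (F : fieldType) (I : eqType) (s : seq I)
    (G : I -> {poly F}) p :
  (forall i, i \in s -> coprimep p (G i)) -> coprimep p (\prod_(i <- s) G i).
Proof.
move=> cop; rewrite big_seq; apply: (big_ind (coprimep p)) => //.
  exact: coprimep1.
by move=> q1 q2; rewrite coprimepMr => -> ->.
Qed.

Lemma dvdp_prod_coprimep (F : fieldType) (I : eqType) (s : seq I)
    (G : I -> {poly F}) p :
  uniq s -> {in s &, forall i j, i != j -> coprimep (G i) (G j)} ->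
  (forall i, i \in s -> G i %| p) -> \prod_(i <- s) G i %| p.
Proof.
elim: s => [|i s IHs] /=; first by rewrite big_nil dvd1p.
case/andP=> i_s uniq_s cop dvd; rewrite big_cons Gauss_dvdp; last first.
  apply: coprimep_prod => j j_s; apply: cop; rewrite ?inE ?eqxx ?j_s ?orbT //.
  by apply: contraNneq i_s => ->.
rewrite dvd ?mem_head //=; apply: IHs => // [j k j_s k_s|j j_s].
  by apply: cop; rewrite inE ?j_s ?k_s orbT.
by apply: dvd; rewrite inE j_s orbT.
Qed.

(** By linearity it suffices to treat the monomials ['X^e], where the condition is a square
    Vandermonde system, invertible because the nodes are distinct. *)
Lemma ex_leading_coef_weights (F : fieldType) (m : nat) (b : 'I_m.+1 -> F) :
  injective b ->
  exists c : 'I_m.+1 -> F,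
    forall g : {poly F}, (size g <= m.+1)%N -> \sum_i c i * g.[b i] = g`_m.
Proof.
move=> inj_b; pose V := Vandermonde m.+1 (\row_i b i).
have V_unit : V \in unitmx.
  rewrite unitmxE det_Vandermonde unitfE; apply/prodf_neq0 => i _.
  apply/prodf_neq0 => j lt_ij; rewrite !mxE subr_eq0; apply/eqP => /inj_b eq_ij.
  by rewrite eq_ij ltnn in lt_ij.
(* The weights form the last column of the inverse of [V]. *)
pose c := invmx V *m delta_mx ord_max (ord0 : 'I_1); exists (fun i => c i 0).
have cE (e : 'I_m.+1) : \sum_i c i 0 * b i ^+ e = (e == ord_max)%:R.
  have /matrixP/(_ e 0) : V *m c = delta_mx ord_max 0 by rewrite mulKVmx.
  rewrite !mxE eqxx andbT => <-.
  by apply: eq_bigr => i _; rewrite !mxE mulrC.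
move=> g size_g.
under eq_bigr => i _ do rewrite (horner_coef_wide _ size_g) mulr_sumr.
rewrite exchange_big (bigD1 ord_max) //=.
rewrite [X in _ + X]big1 ?addr0 => [|e /negPf ne_e].
  under eq_bigr => i _ do rewrite mulrCA.
  by rewrite -mulr_sumr (cE ord_max) eqxx mulr1.
under eq_bigr => i _ do rewrite mulrCA.
by rewrite -mulr_sumr cE ne_e mulr0.
Qed.

Lemma dvdp_Xn_coef0 (F : fieldType) (m : nat) (p : {poly F}) :
  (forall e, (e < m)%N -> p`_e = 0) -> 'X^m %| p.
Proof.
move=> p0; rewrite -(poly_take_drop m p).
suff -> : take_poly m p = 0 by rewrite add0r dvdp_mull.
by apply/polyP=> e; rewrite coef_take_poly coef0; case: ifP => // /p0.
Qed.

(** * The Stepanov polynomial and its leading coefficient *)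

Lemma leq_of_difference_roots_of_unity (F : fieldType) (m M : nat)
    (b : 'I_m.+1 -> F) :
  injective b -> (forall i j, i != j -> (b i - b j) ^+ M = 1) ->
  (0 < M)%N -> 'C(m + M, m)%:R != 0 :> F -> (m.+1 * m <= M)%N.
Proof.
move=> inj_b pow_b M_gt0 bin_neq0.
have [c cE] := ex_leading_coef_weights inj_b.
have cexp j e : (e <= m)%N -> \sum_i c i * (b i - b j) ^+ e = (e == m)%:R.
  move=> le_em; have := cE (('X - (b j)%:P) ^+ e); rewrite size_exp_XsubC ltnS.
  move=> /(_ le_em); under eq_bigr => i _ do rewrite horner_exp hornerXsubC.
  move=> ->; case: eqP => [->|/eqP ne_em].
    have := monic_exp m (monicXsubC (b j)).
    by rewrite monicE lead_coefE size_exp_XsubC => /eqP.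
  by rewrite nth_default // size_exp_XsubC ltn_neqAle ne_em.
have cexp0 e : (e <= m)%N -> \sum_i c i * b i ^+ e = (e == m)%:R.
  move=> le_em; have := cE 'X^e; rewrite size_polyXn ltnS => /(_ le_em).
  under eq_bigr => i _ do rewrite hornerXn.
  by move=> ->; rewrite coefXn eq_sym.
pose f := \sum_i c i *: ('X + (b i)%:P) ^+ (m + M) - 1.
have f_dvd j : ('X + (b j)%:P) ^+ m %| f.
  (* The shift by [b j] moves the root [- b j] to 0, so its multiplicity is read off the
     coefficients below [m]. *)
  have dvd_f : 'X^m %| f \Po ('X - (b j)%:P).
    apply: dvdp_Xn_coef0 => e lt_em.
    rewrite rmorphB rmorph1 /= raddf_sum /= coefB coef_sum coef1.
    under eq_bigr => i _.
      rewrite linearZ rmorphXn rmorphD /= comp_polyX comp_polyC coefZ.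
      rewrite -addrA [- _ + _]addrC -polyCB coef_XaddC_exp.
      (* Lowering the exponent by [M] leaves a power at most [m], on which
         [cexp] applies; at [i = j] both powers vanish since [e < m]. *)
      have -> : (b i - b j) ^+ (m + M - e) = (b i - b j) ^+ (m - e).
        case: (eqVneq i j) => [->|/pow_b pow1].
          by rewrite subrr !expr0n !subn_eq0 leqNgt ltn_addr // leqNgt lt_em.
        by rewrite addnC -addnBA 1?ltnW // exprD pow1 mul1r.
      rewrite mulrnAr; over.
    rewrite /= sumrMnl (cexp j) ?leq_subr //.
    (* The weighted sum survives only when [m - e = m], that is at [e = 0], where its value 1
       cancels the [- 1] in [f]. *)
    case: e lt_em => [|e] lt_em; first by rewrite subn0 eqxx bin0 subrr.
    rewrite (_ : m - e.+1 == m = false)%N ?mul0rn ?subr0 // ltn_eqF //.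
    by rewrite ltn_subrL (leq_ltn_trans _ lt_em).
  have -> : f = (f \Po ('X - (b j)%:P)) \Po ('X + (b j)%:P).
    rewrite -comp_polyA [_ \Po ('X + _)]comp_polyB comp_polyX comp_polyC addrK.
    by rewrite comp_polyXr.
  have -> : ('X + (b j)%:P) ^+ m = 'X^m \Po ('X + (b j)%:P).
    by rewrite rmorphXn /= comp_polyX.
  exact: dvdp_comp_poly.
have coef_f e : (M <= e)%N ->
    f`_e = (if e == M then 'C(m + M, m)%:R else 0).
  move=> le_Me; rewrite coefB coef_sum coef1.
  (* Since [M] is positive, the constant [- 1] does not reach these coefficients. *)
  rewrite gtn_eqF ?(leq_trans M_gt0) // subr0.
  under eq_bigr => i _ do rewrite coefZ coef_XaddC_exp mulrnAr.
  rewrite sumrMnl cexp0; last by lia.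
  case: (eqVneq e M) => [->|ne_eM].
    by rewrite addnK eqxx -bin_sub ?leq_addl ?addnK.
  (* Beyond [m + M] the truncated exponent is 0, which equals [m] when [m = 0]; there the binomial
     coefficient gives the vanishing. *)
  have [le_e|/bin_small->] := leqP e (m + M); last by rewrite mulr0n.
  by rewrite (_ : _ == m = false) ?mul0rn //; lia.
clearbody f.
have size_f : size f = M.+1.
  apply/eqP; rewrite eqn_leq; apply/andP; split.
    apply/leq_sizeP => e lt_Me.
    by rewrite (coef_f e (ltnW lt_Me)) (gtn_eqF lt_Me).
  rewrite ltnNge; apply: contraNN bin_neq0 => /leq_sizeP/(_ M (leqnn M)).
  by rewrite (coef_f M (leqnn M)) eqxx => ->.
have XaddE i : 'X + (b i)%:P = 'X - (- b i)%:P by rewrite polyCN opprK.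
(* The points [- b j] are distinct, so their multiplicities add up to at most the degree [M] of
   [f]. *)
have : \prod_(j : 'I_m.+1) ('X + (b j)%:P) ^+ m %| f.
  apply: dvdp_prod_coprimep => [|i j _ _ ne_ij|j _]; last exact: f_dvd.
    exact: index_enum_uniq.
  apply: coprimep_expl; apply: coprimep_expr.
  rewrite !XaddE coprimep_XsubC2 //.
  by rewrite opprK addrC subr_eq0 (inj_eq inj_b).
move=> /dvdp_leq; rewrite -size_poly_eq0 size_f => /(_ isT).
under eq_bigr => i _ do rewrite XaddE.
rewrite prodrXl => le_size.
have := size_exp (\prod_(i < m.+1) ('X - (- b i)%:P)) m.
have size_index : size (index_enum 'I_m.+1) = m.+1.
  by rewrite [index_enum _]unlock -enumT size_enum_ord.
by rewrite size_prod_XsubC size_index /= => <-; case: (size _) le_size.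
Qed.

(* A special case of Lucas' theorem: multiplying by [(X + 1)^k = X^k + 1] adds
   [1] to the coefficient of [X^k]. *)
Lemma bin_pchar_natr (R : comNzRingType) (k u v : nat) :
  [pchar R].-nat k -> (v < k)%N -> 'C(k * u + v, k)%:R = u%:R :> R.
Proof.
move=> pchar_k lt_vk; elim: u => [|u IHu].
  by rewrite muln0 bin_small.
have coef_bin n e : (('X + 1 : {poly R}) ^+ n)`_e = 'C(n, e)%:R.
  by rewrite -[1 in LHS]/(1%:P) coef_XaddC_exp expr1n.
rewrite -coef_bin mulnS -addnA exprD exprDn_pchar; last first.
  by rewrite (eq_pnat _ (pchar_poly _)).
rewrite expr1n mulrDl mul1r coefD coefXnM ltnn subnn !coef_bin IHu bin0.
by rewrite nat1r.
Qed.

(** * Characteristic, subfields and power residues of a finite field *)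

Lemma card_finField_pchar (F : finFieldType) (p n : nat) :
  prime p -> #|F| = (p ^ n)%N -> p \in [pchar F].
Proof.
move=> p_prime cardF; rewrite inE /= p_prime /=.
have : (#|F|)%:R = 0 :> F.
  have := @expg_cardG _ [set: F]%G (1%R : F) (in_setT _).
  by rewrite zmodXgE cardsT.
rewrite cardF natrX => /eqP; rewrite expf_eq0; by case/andP.
Qed.

Lemma subfield_group_set (F : finFieldType) (K : {set F}) :
  divring_closed K -> group_set K.
Proof.
case=> K1 KB _; have K0 : 0 \in K by rewrite -(subrr 1) KB.
apply/group_setP; split=> // x y Kx Ky.
by rewrite zmodMgE -[y]opprK KB // -sub0r KB.
Qed.

Lemma card_subfield_dvd (F : finFieldType) (K : {set F}) :
  divring_closed K -> (#|K| %| #|F|)%N.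
Proof.
move=> K_subfield; rewrite -cardsT.
exact: cardSg (subsetT (Group (subfield_group_set K_subfield))).
Qed.

Lemma subfield_units_group_set (F : finFieldType) (K : {set F}) :
  divring_closed K -> group_set [set u : {unit F} | val u \in K].
Proof.
case=> K1 _ KV; apply/group_setP; split=> [|u v]; rewrite !inE //= => Ku Kv.
by rewrite -[val v]invrK KV // -div1r KV.
Qed.

Lemma card_subfield_units (F : finFieldType) (K : {set F}) :
  divring_closed K -> #|[set u : {unit F} | val u \in K]| = #|K|.-1.
Proof.
case=> K1 KB _; have K0 : 0 \in K by rewrite -(subrr 1) KB.
rewrite (cardsD1 0 K) K0 /= -(card_imset _ val_inj); apply: eq_card => x.
rewrite !inE; apply/imsetP/andP=> [[u] | [x_neq0 Kx]].
  by rewrite inE => Ku ->; rewrite -unitfE (valP u).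
have x_unit : x \is a GRing.unit by rewrite unitfE.
by exists (FinRing.Unit x_unit); rewrite ?inE.
Qed.

(** The unit group is cyclic of order [d * M]: for a generator [g], the power [g ^ (i * M)] is
    trivial exactly when [d] divides [i]. *)
Lemma mem_nonzero_powers (F : finFieldType) (d M : nat) (x : F) :
  (#|F|.-1 = d * M)%N -> x != 0 -> (x \in nonzero_powers F d) = (x ^+ M == 1).
Proof.
move=> cardF x_neq0; apply/imsetP/eqP=> [[y]|xM1].
  rewrite inE -unitfE => y_unit ->.
  rewrite -exprM -cardF -card_finField_unit.
  have := expg_cardG (in_setT (FinRing.Unit y_unit)).
  by move/(congr1 val); rewrite FinRing.val_unitX.
have x_unit : x \is a GRing.unit by rewrite unitfE.
have M_gt0 : (0 < M)%N.
  have : (0 < #|F|.-1)%N by rewrite -card_finField_unit cardG_gt0.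
  by rewrite cardF muln_gt0 => /andP[].
have /cyclicP[g gE] := field_unit_group_cyclic [set: {unit F}]%G.
have : FinRing.Unit x_unit \in <[g]>%g by rewrite -gE inE.
case/cycleP=> i xE.
have : (#[g]%g %| i * M)%N.
  rewrite order_dvdn expgM -xE; apply/eqP/val_inj.
  by rewrite FinRing.val_unitX.
rewrite orderE -gE card_finField_unit cardF dvdn_pmul2r // => /dvdnP[j def_i].
exists (val (g ^+ j)%g); first by rewrite inE -unitfE (valP (g ^+ j)%g).
by rewrite -FinRing.val_unitX -expgM -def_i -xE.
Qed.

Lemma subfield_expr_pred_card (F : finFieldType) (K : {set F}) (x : F) :
  divring_closed K -> x \in K -> x != 0 -> x ^+ #|K|.-1 = 1.
Proof.
move=> K_subfield Kx x_neq0; have x_unit : x \is a GRing.unit by rewrite unitfE.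
have Ku : FinRing.Unit x_unit \in Group (subfield_units_group_set K_subfield).
  by rewrite inE.
have := expg_cardG Ku; rewrite (card_subfield_units K_subfield).
by move/(congr1 val); rewrite FinRing.val_unitX.
Qed.

Lemma dvdn_pred_card_subfield (F : finFieldType) (K : {set F}) :
  divring_closed K -> (#|K|.-1 %| #|F|.-1)%N.
Proof.
move=> K_subfield.
rewrite -(card_subfield_units K_subfield) -card_finField_unit.
exact: cardSg (subsetT (Group (subfield_units_group_set K_subfield))).
Qed.

(* From the degree bound to the clique number *)
Local Close Scope ring_scope.

(** If [p] divided [(M %/ k).+1], the last base-[p] digit of [M %/ k] would be [p - 1], making the
    remainder at least [(p - 1) * k]. This keeps the leading coefficient of the Stepanov polynomial
    nonzero. *)
Lemma succ_divn_ndvd (p k M : nat) : 0 < p -> 0 < k ->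
  M %% (p * k) < (p - 1) * k -> ~~ (p %| (M %/ k).+1).
Proof.
move=> p_gt0 k_gt0; apply: contraL => /dvdnP[[|t] def_t]; first by lia.
have -> : M = t * (p * k) + ((p - 1) * k + M %% k).
  rewrite {1}(divn_eq M k) addnA; congr (_ + _).
  by rewrite mulnA -mulnDl; congr (_ * _); nia.
have := ltn_pmod M k_gt0; move: (M %% k) => v lt_vk.
by rewrite modnMDl modn_small -?leqNgt ?leq_addr //; nia.
Qed.

Lemma clique_card_le (F : finFieldType) (p n k M d : nat) (C : {set F}) :
  prime p -> #|F| = p ^ n -> k %| #|F| -> #|F|.-1 = d * M ->
  M %% (p * k) < (p - 1) * k -> M < k.+1 * k ->
  is_clique (paley_graph F d) C -> #|C| <= k.
Proof.
move=> p_prime cardF k_dvd cardF1 M_mod M_lt /forall_inP cliqueC.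
have pcharF := card_finField_pchar p_prime cardF.
have [p_gt0 k_gt0] : 0 < p /\ 0 < k by rewrite prime_gt0 //; split=> //; lia.
have M_gt0 : 0 < M.
  have : 0 < #|F|.-1 by rewrite -card_finField_unit cardG_gt0.
  by rewrite cardF1 muln_gt0 => /andP[].
rewrite leqNgt; apply/negP => lt_kC.
pose b (i : 'I_k.+1) := nth 0%R (enum C) i.
have lt_b (i : 'I_k.+1) : i < size (enum C).
  by rewrite -cardE (leq_trans (ltn_ord i)).
have Cb i : b i \in C by rewrite -mem_enum mem_nth.
have inj_b : injective b.
  move=> i j /eqP; rewrite nth_uniq ?enum_uniq //.
  by move/eqP/val_inj.
suff : k.+1 * k <= M by rewrite leqNgt M_lt.
apply: (leq_of_difference_roots_of_unity inj_b) => // [i j ne_ij|].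
  have /forall_inP/(_ _ (Cb j)) := cliqueC _ (Cb i).
  rewrite (inj_eq inj_b) ne_ij /paley_graph /=.
  rewrite (mem_nonzero_powers cardF1) => [/eqP//|].
  by rewrite subr_eq0 (inj_eq inj_b).
(* In this form [bin_pchar_natr] evaluates the binomial coefficient to [(M %/ k).+1] in [F]; it
   applies because [k], a divisor of [p ^ n], is a power of [p]. *)
have -> : k + M = k * (M %/ k).+1 + M %% k.
  by rewrite {1}(divn_eq M k) mulnS mulnC addnA.
rewrite bin_pchar_natr ?ltn_pmod //.
  by rewrite -(dvdn_pcharf pcharF) succ_divn_ndvd.
move: k_dvd; rewrite cardF => /(dvdn_pfactor _ _ p_prime)[s _ ->].
by rewrite (eq_pnat _ (pcharf_eq pcharF)) pnatX pnat_id.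
Qed.

Theorem proposition4p1 (p n q : nat) (p_prime : prime p) (p_odd : odd p)
    (q_def : q = p ^ n)
    (F : finFieldType) (card_F : #|F| = q)
    (K : {set F}) (K_subfield : is_subfield K) (K_proper : K \proper [set: F])
    (d : nat) (d_ge2 : 2 <= d) (d_dvd : d %| (q - 1) %/ (#|K| - 1))
    (q_lt : q < d * #|K| * (#|K| + 1))
    (r : nat) (r_def : r = ((q - 1) %/ d) %% (p * #|K|)) :
  r < (p - 1) * #|K| -> clique_number (paley_graph F d) = #|K|.
Proof.
move=> r_lt; subst q r.
have cardF1 : #|F|.-1 = p ^ n - 1 by rewrite card_F subn1.
have K_pred_dvd := dvdn_pred_card_subfield K_subfield.
have k_gt1 : 1 < #|K|.
  case: K_subfield => K1 KB _.
  rewrite (cardD1 0%R) (cardD1 1%R) !inE oner_neq0 K1.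
  by rewrite -(subrr 1%R) KB.
(* The divisibility hypothesis on [d] says equally that [#|K|.-1] divides [(q - 1) / d]; [s] is the
   quotient. *)
have [s def_s] : exists s, p ^ n - 1 = d * (#|K|.-1 * s).
  case/dvdnP: d_dvd => s def_s; exists s.
  rewrite -cardF1 -(divnK K_pred_dvd) cardF1 -subn1 def_s.
  by rewrite -mulnA mulnC -mulnA.
set M := (p ^ n - 1) %/ d in r_lt.
have M_def : M = #|K|.-1 * s by rewrite /M def_s mulKn // ltnW.
have {}cardF1 : #|F|.-1 = d * M by rewrite cardF1 def_s M_def.
apply/eqP; rewrite eqn_leq; apply/andP; split.
  apply/bigmax_leqP => C; apply: (clique_card_le p_prime card_F _ cardF1 r_lt).
    exact: card_subfield_dvd.
  (* Multiplied by [d], the bound on [M] follows from [d * M = q - 1 < q]. *)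
  rewrite -(ltn_pmul2l (ltnW d_ge2)) -cardF1 card_F.
  rewrite (leq_ltn_trans (leq_pred _)) //.
  by rewrite -(addn1 #|K|) [_ * #|K|]mulnC mulnA.
(* [K] is itself a clique: a nonzero difference lies in [K], so its power [#|K|.-1] is 1, and hence
   so is its [M]-th power. *)
apply: (@bigmax_sup _ K) => //.
apply/forall_inP => x Kx; apply/forall_inP => y Ky; apply/implyP => ne_xy.
have xy_neq0 : (x - y != 0)%R by rewrite subr_eq0.
rewrite /paley_graph /= (mem_nonzero_powers cardF1) // M_def exprM.
rewrite subfield_expr_pred_card //.
  by rewrite expr1n.
by case: K_subfield => _ KB _; apply: KB.
Qed.
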